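(* Let $k\ge 1$ be an integer, let $S$ be a $k$-diagrammable set with diagram metric $\varrho$ (that is, $\varrho$ is a metric on $S^2$ for which the set $\{x\in S^2:\varrho(x,\Delta_S)=k\}$ is unbounded), and let $\mathcal{D}_S$ be the set of all diagrams on $S$. Then the space $(\mathcal{D}_S,W_\varrho)$ has $k$-prisms.
   Context: For a set $S$, $\Delta_S=\{(s,s)\in S^2: s\in S\}$. A diagram on $S$ is a function $D\colon S^2\to\mathbb{Z}_{\ge 0}$ such that $D(p)=0$ for all but finitely many $p\in S^2$ and $D(p)=0$ for all $p\in\Delta_S$. The associated labeled diagram is the finite set $\widetilde{D}=\{(x,i): x\in S^2,\ 1\le i\le D(x)\}$. Let $\varrho$ be a metric on $S^2$, and write $\varrho(x,\Delta_S)=\inf\{\varrho(x,z): z\in\Delta_S\}$. For elements $\tilde x=(x,i)$, $\tilde y=(y,j)$ of labeled diagrams, $\varrho(\tilde x,\tilde y)=\varrho(x,y)$ and $\|\tilde x\|=\inf\{\varrho(x,z): z\in\Delta_S\}$. A partial matching of labeled diagrams $\widetilde D_X$ and $\widetilde D_Y$ is a subset $\tilde m\subseteq\widetilde D_X\times\widetilde D_Y$ in which each element of $\widetilde D_X$ and each element of $\widetilde D_Y$ occurs in at most one pair; $\pi_1(\tilde m),\pi_2(\tilde m)$ are its coordinate projections. Put $$W_{\tilde m,\varrho}(D_X,D_Y)=\sum_{\tilde x\in\widetilde D_X\setminus\pi_1(\tilde m)}\|\tilde x\|+\sum_{\tilde y\in\widetilde D_Y\setminus\pi_2(\tilde m)}\|\tilde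 y\|+\sum_{(\tilde x,\tilde y)\in\tilde m}\varrho(\tilde x,\tilde y),$$ and let the Wasserstein $\varrho$-distance $W_\varrho(D_X,D_Y)$ be the minimum of $W_{\tilde m,\varrho}(D_X,D_Y)$ over the finite collection of all partial matchings $\tilde m$ of $\widetilde D_X$ and $\widetilde D_Y$. For an integer $k\ge1$, a set $S$ is $k$-diagrammable if there exists a metric $\varrho$ on $S^2$ in which the $k$-shell around the diagonal, $\{x\in S^2:\varrho(x,\Delta_S)=k\}$, is unbounded; such a metric is called a diagram metric. A space $X$ with distance $d$ has $k$-prisms if for any finite set $F\subset X$ there exists a function $T\colon F\to X$ such that (1) $T(F)\cap F=\emptyset$; (2) $d(T(x),T(y))=d(x,y)$ for all $x,y\in F$; and (3) $d(x,T(y))=k+d(x,y)$ for all $x,y\in F$. In the claim this is applied with $X=\mathcal{D}_S$ and $d=W_\varrho$. *)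

(* Defs.v *)
From mathcomp Require Import all_boot all_order all_algebra finmap.
From mathcomp Require Import boolp classical_sets functions cardinality reals.

Set Implicit Arguments.
Unset Strict Implicit.
Unset Printing Implicit Defensive.

Import Order.TTheory GRing.Theory Num.Theory.

Local Open Scope classical_set_scope.
Local Open Scope ring_scope.

(* The metric is an explicit function rather than a [metricType] structure, since
   it is quantified over for the fixed carrier S * S. *)
Record is_metric (R : realType) (X : Type) (rho : X -> X -> R) : Prop := {
  is_metric_ge0 : forall x y, 0 <= rho x y;
  is_metric_eq0 : forall x y, rho x y = 0 <-> x = y;
  is_metric_sym : forall x y, rho x y = rho y x;
  is_metric_triangle : forall x y z, rho x z <= rho x y + rho y z }.

Definition dist_set (R : realType) (X : Type) (rho : X -> X -> R)
  (x : X) (A : set X) : R := inf [set rho x z | z in A].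

Definition bounded_in (R : realType) (X : Type) (rho : X -> X -> R)
  (A : set X) : Prop := exists M : R, forall x y, A x -> A y -> rho x y <= M.

(* [diagonal], from classical_sets, is the set of pairs (s, s). *)
Definition shell (R : realType) (S : Type) (rho : S * S -> S * S -> R)
  (k : nat) : set (S * S) := [set x | dist_set rho x diagonal = k%:R].

(* S is k-diagrammable when such a rho exists. *)
Definition diagram_metric (R : realType) (S : Type) (k : nat)
  (rho : S * S -> S * S -> R) : Prop :=
  is_metric rho /\ ~ bounded_in rho (shell rho k).

Record diagram (S : choiceType) := Diagram {
  diagram_fun :> {fsfun S * S -> nat with 0%N};
  diagram_diag : forall p, diagonal p -> diagram_fun p = 0%N }.

Section Wasserstein.
Variables (R : realType) (S : choiceType) (rho : S * S -> S * S -> R).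

Local Notation point := (S * S * nat)%type.

Definition labeled (D : diagram S) : {fset point} :=
  [fset ((x, i) : point) | x in finsupp D, i in iota 1 (D x)]%fset.

Definition point_dist (x y : point) : R := rho x.1 y.1.

Definition point_norm (x : point) : R := dist_set rho x.1 diagonal.

Definition partial_matching (DX DY : diagram S)
  (m : {fset point * point}) : Prop :=
  [/\ (m `<=` labeled DX `*` labeled DY)%fset,
      {in m &, injective fst} & {in m &, injective snd}].

Definition partial_matchings (DX DY : diagram S) : {fset {fset point * point}} :=
  [fset m in fpowerset (labeled DX `*` labeled DY)
    | `[< partial_matching DX DY m >]]%fset.

Definition matching_cost (DX DY : diagram S) (m : {fset point * point}) : R :=
  \sum_(x <- (labeled DX `\` [fset p.1 | p in m])%fset) point_norm x
  + \sum_(y <- (labeled DY `\` [fset p.2 | p in m])%fset) point_norm y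
  + \sum_(p <- m) point_dist p.1 p.2.

(* The default value of the minimum is the cost of the empty matching, which is
   itself one of the partial matchings; see [wasserstein_le] and
   [wasserstein_attained]. *)
Definition wasserstein (DX DY : diagram S) : R :=
  \big[Order.min/matching_cost DX DY fset0]_(m <- partial_matchings DX DY)
    matching_cost DX DY m.

Lemma labeledP (D : diagram S) (x : point) :
  x \in labeled D = (1 <= x.2 <= D x.1)%N.
Proof.
case: x => x i /=; apply/imfset2P/idP => /= [[y yD [j]]|].
  by rewrite mem_iota add1n ltnS => jD [-> ->].
move=> iD; exists x; last by exists i => //; rewrite mem_iota add1n ltnS.
rewrite mem_finsupp; apply: contraTneq iD => ->.
by case: i.
Qed.

Lemma partial_matchingsP (DX DY : diagram S) (m : {fset point * point}) :
  m \in partial_matchings DX DY <-> partial_matching DX DY m.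
Proof.
split=> [|mP]; first by case/imfsetP => ? /andP[_ /asboolP ?] ->.
apply/imfsetP; exists m => //=; apply/andP; split; last exact/asboolP.
by rewrite fpowersetE; case: mP.
Qed.

Lemma wasserstein_le (DX DY : diagram S) (m : {fset point * point}) :
  partial_matching DX DY m -> wasserstein DX DY <= matching_cost DX DY m.
Proof. by move=> /partial_matchingsP mP; apply: ge_bigmin_seq. Qed.

Lemma wasserstein_attained (DX DY : diagram S) :
  exists2 m, partial_matching DX DY m & wasserstein DX DY = matching_cost DX DY m.
Proof.
rewrite /wasserstein big_seq.
elim/big_ind: _ => [|_ _ [m1 m1P ->] [m2 m2P ->]|m /partial_matchingsP mP].
- by exists fset0 => //; split=> [|? ?|? ?]; rewrite ?fsub0set ?inE.
- by case: (leP (matching_cost DX DY m1)); [exists m1 | exists m2].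
- by exists m.
Qed.

End Wasserstein.

Definition has_prisms (R : realType) (X : Type) (d : X -> X -> R) (k : nat) : Prop :=
  forall F : set X, finite_set F ->
  exists T : X -> X,
    [/\ T @` F `&` F = set0,
        forall x y, F x -> F y -> d (T x) (T y) = d x y
      & forall x y, F x -> F y -> d x (T y) = k%:R + d x y].

(* Main.v *)
Require Import Defs.
From mathcomp Require Import all_boot all_order all_algebra.
From mathcomp Require Import reals.
From mathcomp Require Import finmap boolp classical_sets functions cardinality.
From mathcomp Require Import lra.

(** The idea is to translate every diagram of the finite family [F] by one
    and the same extra off-diagonal point [z], taken on the [k]-shell and so far
    from all the points occurring in [F] that matching [z] with one of them
    never beats leaving both unmatched.

    Relative to the empty matching, a pair [(x, y)] of a matching changes the
    cost by its excess [rho x y - ||x|| - ||y||], so that the cost of a matching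
    is the total norm of the two diagrams plus the sum of the excesses of its
    pairs ([matching_costE]).  In this form the diagrams enter the cost only
    through their total norms, and a pair can be added or removed freely.
    Adjoining [z] to a diagram raises its total norm by [||z|| = k].  The pairs
    that join [z] to an old point have nonnegative excess by the choice of [z],
    so they can be dropped from an optimal matching; the pair [(z, z)] has
    excess [- 2k], which exactly cancels the two added norms.  Hence adjoining
    [z] to both diagrams preserves the distance, and adjoining it to one of them
    raises the distance by [k].

    A suitable [z] exists because the shell is unbounded: it leaves every ball,
    hence has points arbitrarily far from a finite set ([exists_far_in_set]).
    Being far also keeps [z] out of the supports of the diagrams of [F], so the
    translated diagrams are not in [F]. *)

Set Implicit Arguments.
Unset Strict Implicit.
Unset Printing Implicit Defensive.

Import Order.TTheory GRing.Theory Num.Theory.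

Local Open Scope classical_set_scope.
Local Open Scope ring_scope.

(** * Distance to a set, and unbounded sets *)

Section Metric.
Variables (R : realType) (X : eqType) (rho : X -> X -> R).
Hypothesis rhoP : is_metric rho.

Lemma dist_set_ge0 (x : X) (A : set X) : 0 <= dist_set rho x A.
Proof.
have [->|/set0P[a Aa]] := eqVneq A set0.
  by rewrite /dist_set image_set0 inf0.
apply: lb_le_inf; first by exists (rho x a), a.
by move=> _ [b _ <-]; apply: is_metric_ge0.
Qed.

Lemma dist_set_mem (x : X) (A : set X) : A x -> dist_set rho x A = 0.
Proof.
move=> Ax; apply/le_anti; rewrite dist_set_ge0 andbT.
rewrite -(proj2 (is_metric_eq0 rhoP x x) erefl).
apply: ge_inf; last by exists x.
by exists 0 => _ [b _ <-]; apply: is_metric_ge0.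
Qed.

(** If every point of [A] were within a fixed distance of a point [a], then [A]
    would lie in a ball around [a].  A point far enough from [a] is, by the
    triangle inequality, far from any finite number of points. *)
Lemma exists_far_in_set (A : set X) (s : seq X) (f : X -> R) :
  ~ bounded_in rho A -> (forall p, 0 <= f p) ->
  exists2 z, A z & {in s, forall p, f p <= rho z p}.
Proof.
move=> unbA f0.
have [a Aa] : exists a, A a.
  apply: contrapT => noA; apply: unbA; exists 0 => x y Ax.
  by case: noA; exists x.
pose M := \sum_(p <- s) (rho p a + f p).
have [z Az Mz] : exists2 z, A z & M <= rho z a.
  apply: contrapT => near; apply: unbA; exists (M + M) => x y Ax Ay.
  have nearM u : A u -> rho u a <= M.
    by move=> Au; rewrite leNgt; apply/negP => /ltW Mu; apply: near; exists u.
  apply: le_trans (is_metric_triangle rhoP x a y) _.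
  by rewrite lerD ?nearM // (is_metric_sym rhoP) nearM.
exists z => // p sp.
have termM : rho p a + f p <= M.
  rewrite /M (big_rem p) //= lerDl; apply: sumr_ge0 => q _.
  by rewrite addr_ge0 ?f0 // (is_metric_ge0 rhoP).
have := is_metric_triangle rhoP z p a; lra.
Qed.

End Metric.

(** * The cost of a matching in terms of excesses *)

Section Excess.
Variables (R : realType) (S : choiceType) (rho : S * S -> S * S -> R).

Local Notation point := (S * S * nat)%type.
Local Notation norm := (point_norm rho).

Definition total_norm (D : diagram S) : R := \sum_(x <- labeled D) norm x.

Definition excess (p : point * point) : R :=
  point_dist rho p.1 p.2 - norm p.1 - norm p.2.

Lemma sum_fsetD_imfset (T U : choiceType) (A : {fset U}) (m : {fset T})
    (h : T -> U) (f : U -> R) :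
  {in m &, injective h} -> (forall p, p \in m -> h p \in A) ->
  \sum_(x <- (A `\` [fset h p | p in m])%fset) f x =
  \sum_(x <- A) f x - \sum_(p <- m) f (h p).
Proof.
move=> injh hA.
have <- : \sum_(x <- [fset h p | p in m]%fset) f x = \sum_(p <- m) f (h p).
  by rewrite big_imfset.
rewrite [X in _ = X - _](big_fsetID _ (mem [fset h p | p in m]%fset)) /=.
have -> : [fset x in A | x \in [fset h p | p in m]]%fset = [fset h p | p in m]%fset.
  apply/fsetP => x; rewrite !inE /= andbC; apply: andb_idr.
  by case/imfsetP => p pm ->; apply: hA.
have -> : [fset x in A | x \notin [fset h p | p in m]]%fset =
          (A `\` [fset h p | p in m])%fset.
  by apply/fsetP => x; rewrite !inE /= andbC.
by rewrite [X in _ = X - _]addrC addrK.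
Qed.

(** The coordinate projections are injective on a matching, so the norms missing
    from the two sums over unmatched points can be charged to the pairs. *)
Lemma matching_costE (D E : diagram S) (m : {fset point * point}) :
  partial_matching D E m ->
  matching_cost rho D E m = total_norm D + total_norm E + \sum_(p <- m) excess p.
Proof.
case=> /fsubsetP mDE inj1 inj2; rewrite /matching_cost.
rewrite !sum_fsetD_imfset //; last 2 first.
- by move=> p /mDE; rewrite inE => /andP[].
- by move=> p /mDE; rewrite inE => /andP[].
rewrite /excess /total_norm !sumrB; lra.
Qed.

Lemma wasserstein_le_excess (D E : diagram S) (m : {fset point * point}) :
  partial_matching D E m ->
  wasserstein rho D E <= total_norm D + total_norm E + \sum_(p <- m) excess p.
Proof. by move=> mP; rewrite -matching_costE //; apply: wasserstein_le. Qed.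

Lemma wasserstein_excess_attained (D E : diagram S) :
  exists2 m, partial_matching D E m
    & wasserstein rho D E = total_norm D + total_norm E + \sum_(p <- m) excess p.
Proof.
have [m mP ->] := wasserstein_attained rho D E.
by exists m; rewrite ?matching_costE.
Qed.

(** Restricting an optimal matching of [D'] and [E'] to the pairs of points of
    [D] and [E] loses exactly the excess of the dropped pairs. *)
Lemma wasserstein_restrict (D E D' E' : diagram S) (c : R) :
  (forall m, partial_matching D' E' m ->
     c <= \sum_(p <- m | ~~ ((p.1 \in labeled D) && (p.2 \in labeled E))) excess p) ->
  wasserstein rho D E - total_norm D - total_norm E + c
    <= wasserstein rho D' E' - total_norm D' - total_norm E'.
Proof.
move=> cP; have [m mP ->] := wasserstein_excess_attained D' E'.
pose kept (p : point * point) := (p.1 \in labeled D) && (p.2 \in labeled E).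
have keptP : partial_matching D E [fset p in m | kept p]%fset.
  case: mP => _ inj1 inj2; split.
  - by apply/fsubsetP => p; rewrite !inE /= => /andP[].
  - by move=> p q; rewrite !inE /= => /andP[pm _] /andP[qm _]; apply: inj1.
  - by move=> p q; rewrite !inE /= => /andP[pm _] /andP[qm _]; apply: inj2.
have := wasserstein_le_excess keptP; rewrite big_fset /=.
have := cP m mP.
rewrite [X in _ -> _ -> _ <= _ + X - _ - _](bigID kept) /=.
lra.
Qed.

End Excess.

(** * Adjoining a point to a diagram *)

Section Adjoin.
Variables (S : choiceType) (z : S * S) (zND : ~ diagonal z).

Lemma adjoin_diag (D : diagram S) (p : S * S) :
  diagonal p -> [fsfun D with z |-> (D z).+1] p = 0%N.
Proof.
move=> dp; rewrite fsfun_withE; case: eqP => [pz|_]; last exact: diagram_diag.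
by case: zND; rewrite -pz.
Qed.

Definition adjoin (D : diagram S) : diagram S := Diagram (@adjoin_diag D).

Lemma labeled_adjoin (D : diagram S) :
  D z = 0%N -> labeled (adjoin D) = ((z, 1%N) |` labeled D)%fset.
Proof.
move=> Dz; apply/fsetP => -[x i]; rewrite !inE !labeledP /= fsfun_withE xpair_eqE.
case: eqP => [->|_]; rewrite ?Dz //=.
by case: i => [|[|i]].
Qed.

Variables (R : realType) (rho : S * S -> S * S -> R).

Lemma total_norm_adjoin (D : diagram S) : D z = 0%N ->
  total_norm rho (adjoin D) = dist_set rho z diagonal + total_norm rho D.
Proof.
by move=> Dz; rewrite /total_norm labeled_adjoin // big_fsetU1 // labeledP /= Dz.
Qed.

Hypothesis rhoP : is_metric rho.

Let far (D : diagram S) := forall p, p \in finsupp D ->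
  dist_set rho z diagonal + dist_set rho p diagonal <= rho z p.

Lemma excess_far (D : diagram S) (x : S * S * nat) : far D -> x \in labeled D ->
  0 <= excess rho ((z, 1%N), x) /\ 0 <= excess rho (x, (z, 1%N)).
Proof.
move=> farD; rewrite labeledP => xD.
have /farD : x.1 \in finsupp D.
  by rewrite mem_finsupp; apply: contraTneq xD => ->; case: (x.2).
rewrite /excess /point_dist /point_norm /= (is_metric_sym rhoP x.1 z); lra.
Qed.

Section TwoDiagrams.
Variables D E : diagram S.
Hypotheses (Dz : D z = 0%N) (Ez : E z = 0%N) (farD : far D) (farE : far E).

Lemma wasserstein_adjoin_r :
  wasserstein rho D (adjoin E) = dist_set rho z diagonal + wasserstein rho D E.
Proof.
have normE := total_norm_adjoin Ez.
apply/le_anti/andP; split.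
  (* The new point is left unmatched. *)
  have [m [/fsubsetP mDE inj1 inj2] ->] := wasserstein_excess_attained rho D E.
  have mP : partial_matching D (adjoin E) m.
    split=> //; apply/fsubsetP => p /mDE.
    by rewrite labeled_adjoin // !inE => /andP[-> ->]; rewrite orbT.
  have := wasserstein_le_excess rho mP; lra.
suff : wasserstein rho D E - total_norm rho D - total_norm rho E + 0
    <= wasserstein rho D (adjoin E) - total_norm rho D - total_norm rho (adjoin E).
  lra.
apply: wasserstein_restrict => m [/fsubsetP mP _ _].
rewrite big_seq_cond; apply: sumr_ge0 => -[x y] /= /andP[/mP].
rewrite labeled_adjoin // !inE /= => /andP[xD].
rewrite xD /= => /orP[/eqP -> _|->//].
by case: (excess_far farD xD).
Qed.

(** The pair matching the new point with itself makes up for the two added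
    norms, and it is the only pair through the new point whose excess can be
    negative. *)
Lemma wasserstein_adjoin :
  wasserstein rho (adjoin D) (adjoin E) = wasserstein rho D E.
Proof.
have normD := total_norm_adjoin Dz; have normE := total_norm_adjoin Ez.
have zz : excess rho ((z, 1%N), (z, 1%N)) = - 2 * dist_set rho z diagonal.
  rewrite /excess /point_dist /point_norm /=.
  rewrite (proj2 (is_metric_eq0 rhoP z z) erefl); lra.
have zNlab (C : diagram S) : C z = 0%N -> (z, 1%N) \notin labeled C.
  by move=> Cz; rewrite labeledP /= Cz.
apply/le_anti/andP; split.
  have [m [/fsubsetP mDE inj1 inj2] ->] := wasserstein_excess_attained rho D E.
  pose q := ((z, 1%N), (z, 1%N)).
  have z1 p : p \in m -> p.1 != (z, 1%N).
    by move=> /mDE; rewrite inE => /andP[pD _]; apply: contraTneq pD => ->; apply: zNlab.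
  have z2 p : p \in m -> p.2 != (z, 1%N).
    by move=> /mDE; rewrite inE => /andP[_ pE]; apply: contraTneq pE => ->; apply: zNlab.
  have mP : partial_matching (adjoin D) (adjoin E) (q |` m)%fset.
    rewrite /partial_matching !labeled_adjoin //; split.
    - apply/fsubsetP => p; rewrite !inE => /predU1P[->|/mDE]; first by rewrite !eqxx.
      by rewrite inE => /andP[-> ->]; rewrite !orbT.
    - move=> p p'; rewrite !inE.
      move=> /predU1P[->|pm] /predU1P[->|p'm] //=; last exact: inj1.
        by move/esym/eqP; rewrite (negbTE (z1 _ p'm)).
      by move/eqP; rewrite (negbTE (z1 _ pm)).
    - move=> p p'; rewrite !inE.
      move=> /predU1P[->|pm] /predU1P[->|p'm] //=; last exact: inj2.
        by move/esym/eqP; rewrite (negbTE (z2 _ p'm)).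
      by move/eqP; rewrite (negbTE (z2 _ pm)).
  have := wasserstein_le_excess rho mP.
  rewrite big_fsetU1 /=; last by apply/negP => /z1; rewrite eqxx.
  rewrite zz; lra.
suff : wasserstein rho D E - total_norm rho D - total_norm rho E
      + - 2 * dist_set rho z diagonal
    <= wasserstein rho (adjoin D) (adjoin E)
      - total_norm rho (adjoin D) - total_norm rho (adjoin E).
  lra.
apply: wasserstein_restrict => m [/fsubsetP mP _ _].
pose q := ((z, 1%N), (z, 1%N)).
have rest_ge0 p : p \in m -> ~~ ((p.1 \in labeled D) && (p.2 \in labeled E)) ->
    p != q -> 0 <= excess rho p.
  case: p => x y /mP; rewrite !labeled_adjoin // !inE /=.
  move=> /andP[/predU1P[->|xD] /predU1P[->|yE]]; first by rewrite eqxx.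
  - by case: (excess_far farE yE).
  - by case: (excess_far farD xD).
  - by rewrite xD yE.
rewrite big_fset_condE; set B := [fset p in m | _]%fset.
have [qB|qNB] := boolP (q \in B).
  rewrite (big_fsetD1 q) //= zz lerDl big_seq_cond; apply: sumr_ge0 => p.
  by rewrite andbT !inE /= => /and3P[pNq pm /rest_ge0]; apply.
apply: (@le_trans _ _ 0).
  by have := dist_set_ge0 rhoP z diagonal; lra.
rewrite big_seq_cond; apply: sumr_ge0 => p; rewrite andbT => pB.
have pNq : p != q by apply: contraNneq qNB => <-.
by move: pB; rewrite !inE /= => /andP[pm /rest_ge0]; apply.
Qed.

End TwoDiagrams.
End Adjoin.

(** * Prisms *)

Theorem lemma3p8 (R : realType) (S : choiceType) (k : nat) (hk : (1 <= k)%N)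
  (rho : S * S -> S * S -> R) (hrho : diagram_metric k rho) :
  has_prisms (wasserstein rho) k.
Proof.
case: hrho => rhoP unb F finF.
have k0 : (0 : R) < k%:R by rewrite ltr0n.
have /finite_fsetP[P PE] : finite_set (\bigcup_(D in F) [set` finsupp (D : diagram S)]).
  by apply: bigcup_finite => // D _; apply/finite_fsetP; exists (finsupp D).
(* From this distance on, pairing [z] with [p] is no cheaper than leaving both
   unmatched. *)
pose reach p : R := k%:R + dist_set rho p diagonal.
have reach0 p : 0 <= reach p by rewrite addr_ge0 ?ler0n ?dist_set_ge0.
have [z zk zfarP] := exists_far_in_set rhoP P unb reach0.
have zfar (D : diagram S) p : F D -> p \in finsupp D -> reach p <= rho z p.
  move=> FD pD; apply: zfarP.
  by have : [set` P] p by [rewrite -PE; exists D].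
have zND : ~ diagonal z.
  by move=> dz; move: zk k0; rewrite /shell /= dist_set_mem // => <-; rewrite ltxx.
(* A point of the support would be at distance [0] from itself, but its reach is
   at least [k > 0]. *)
have Fz (D : diagram S) : F D -> D z = 0%N.
  move=> FD; apply/eqP; rewrite -[_ == _]negbK -mem_finsupp; apply/negP => /(zfar _ _ FD).
  rewrite (proj2 (is_metric_eq0 rhoP z z) erefl) leNgt.
  by rewrite ltr_wpDr ?dist_set_ge0.
have zfar' (D : diagram S) : F D -> forall p, p \in finsupp D ->
    dist_set rho z diagonal + dist_set rho p diagonal <= rho z p.
  by move=> FD p pD; rewrite zk; apply: zfar pD.
exists (adjoin zND); split=> [|D E FD FE|D E FD FE].
- apply/eqP/negPn/negP => /set0P[_ [[D FD <-] /Fz]] /=.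
  by rewrite fsfun_with.
- exact: wasserstein_adjoin (Fz _ FD) (Fz _ FE) (zfar' _ FD) (zfar' _ FE).
- by rewrite (wasserstein_adjoin_r zND rhoP (Fz _ FE) (zfar' _ FD)) zk.
Qed.
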